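(* Let $G$ and $H$ be arbitrary connected non-trivial graphs where $H$ is not a complete graph. If $tn(G\circ H)=3\cdot tn(G)$, then for every minimum toll set $D$ of $G$ it holds that $N_G(u)\cap N_G(v)=\emptyset$ for any two different vertices $u,v\in D$.
   Context: All graphs are finite, undirected, without loops or multiple edges; a graph is non-trivial if it has at least two vertices. $N_F(x)$ is the open neighborhood of $x$ in $F$. The lexicographic product $G\circ H$ has vertex set $V(G)\times V(H)$, and $(g_1,h_1)$, $(g_2,h_2)$ are adjacent if either $g_1g_2\in E(G)$ or ($g_1=g_2$ and $h_1h_2\in E(H)$). For distinct non-adjacent vertices $u,v$ of a graph $F$, a tolled walk between $u$ and $v$ is a sequence of vertices $u,w_1,\ldots,w_k,v$ with $k\ge 1$ such that $w_iw_{i+1}\in E(F)$ for all $1\le i<k$, $uw_i\in E(F)$ if and only if $i=1$, and $vw_i\in E(F)$ if and only if $i=k$. If $uv\in E(F)$, the only tolled walk between $u$ and $v$ is $u,v$; the only tolled walk from $v$ to $v$ is $v$ itself. The toll interval $T_F(u,v)$ is the set of all vertices lying on some tolled walk between $u$ and $v$. A set $S\subseteq V(F)$ is a toll set of $F$ if $\bigcup_{u,v\in S}T_F(u,v)=V(F)$. The toll number $tn(F)$ is the minimum size of a toll set of $F$; a minimum toll set is a toll set of size $tn(F)$. *)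

(* Defs.v *)
From mathcomp Require Import all_boot boolp.

Set Implicit Arguments.
Unset Strict Implicit.
Unset Printing Implicit Defensive.

Record sgraph := SGraph {
  vertex :> finType;
  adj : rel vertex;
  adj_sym : symmetric adj;
  adj_irrefl : irreflexive adj }.

Definition nontrivial (F : sgraph) : bool := 1 < #|F|.

Definition connected (F : sgraph) : Prop := forall x y : F, connect (@adj F) x y.

Definition complete (F : sgraph) : Prop := forall x y : F, x != y -> adj x y.

Definition nbhd (F : sgraph) (x : F) : {set F} := [set y | adj x y].

Section Lexicographic.

Variables G H : sgraph.

Definition lex_adj : rel (G * H) :=
  fun x y => adj x.1 y.1 || (x.1 == y.1) && adj x.2 y.2.

Lemma lex_adj_sym : symmetric lex_adj.
Proof. by move=> x y; rewrite /lex_adj adj_sym eq_sym (adj_sym x.2). Qed.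

Lemma lex_adj_irrefl : irreflexive lex_adj.
Proof. by move=> x; rewrite /lex_adj !adj_irrefl andbF. Qed.

Definition lex : sgraph := SGraph lex_adj_sym lex_adj_irrefl.

End Lexicographic.

Section Toll.

Variable F : sgraph.
Implicit Types (u v x : F) (p w : seq F) (S : {set F}).

(* Interior w_1, ..., w_k of a tolled walk between distinct non-adjacent
   vertices; w_(i+1) is [nth u w i], so the index is shifted by one. *)
Definition tolled_interior u v w : Prop :=
  [/\ 0 < size w,
      sorted (@adj F) w,
      forall i, i < size w -> (adj u (nth u w i) <-> i = 0)
    & forall i, i < size w -> (adj v (nth u w i) <-> i = (size w).-1)].

(* [p] is the full vertex sequence, both ends included. *)
Definition tolled_walk u v p : Prop :=
  if u == v then p = [:: v]
  else if adj u v then p = [:: u; v]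
  else exists2 w, p = u :: rcons w v & tolled_interior u v w.

Definition toll_interval u v : {set F} :=
  [set x | `[< exists2 p, tolled_walk u v p & x \in p >]].

Definition toll_set S : bool :=
  \bigcup_(u in S) \bigcup_(v in S) toll_interval u v == [set: F].

Lemma toll_setT : toll_set [set: F].
Proof.
rewrite /toll_set -subTset; apply/subsetP => x _.
apply/bigcupP; exists x => //; apply/bigcupP; exists x => //.
rewrite inE; apply/asboolP; exists [:: x]; last by rewrite mem_head.
by rewrite /tolled_walk eqxx.
Qed.

(* The default value [set: F] is a toll set by [toll_setT], so the minimum is
   attained; see [toll_numberP]. *)
Definition toll_number : nat := #|[arg min_(S < [set: F] | toll_set S) #|S|]|.

Lemma toll_numberP :
  (exists2 S, toll_set S & #|S| = toll_number) /\
  (forall S, toll_set S -> toll_number <= #|S|).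
Proof.
rewrite /toll_number; case: arg_minnP => [|S0 tS0 minS0]; first exact: toll_setT.
by split=> //; exists S0.
Qed.

Definition minimum_toll_set S : Prop := toll_set S /\ #|S| = toll_number.

End Toll.

Arguments toll_number : clear implicits.

(* Main.v *)
Require Import Defs.
From mathcomp Require Import all_boot boolp zify.

Set Implicit Arguments.
Unset Strict Implicit.
Unset Printing Implicit Defensive.

(** A toll set [D] of [G] yields a small toll set of [G o H] as soon as some
    set [P] of vertices of [G] totally dominates [D], i.e. every vertex of [D]
    has a neighbour in [P]: for two distinct non-adjacent vertices [h1], [h2]
    of [H], the set [D x {h1} \cup P x {h1, h2}] is a toll set
    ([toll_number_lex_le]).  There are two reasons.

    - Any [phi : G -> H] embeds [G] in [G o H] as the graph of [phi], and
      embeddings carry toll intervals to toll intervals ([toll_interval_emb]).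
      Given [x] outside [D] in the toll interval of two vertices of [D], and any
      [y] in [H], the function equal to [y] at [x] and to [h1] elsewhere shows
      that [(x, y)] is covered by [D x {h1}].

    - A vertex [(d, y)] with [d] in [D] is a common neighbour of [(g, h1)] and
      [(g, h2)], for [g] a neighbour of [d] in [P], and a common neighbour of
      two distinct non-adjacent vertices lies in their toll interval
      ([toll_interval_common_nbr]).

    Thus [tn(G o H) <= |D| + 2|P|].  Choosing one neighbour for each vertex of
    [D] gives [|P| <= |D|], hence the general bound [3 tn(G)]; if two vertices
    of [D] have a common neighbour, it serves for both, so [|P| <= |D| - 1] and
    the bound [3 tn(G)] is not attained. *)

Lemma mem_toll_interval (F : sgraph) (u v x : F) :
  x \in toll_interval u v <-> exists2 p, tolled_walk u v p & x \in p.
Proof. by rewrite inE; split=> [/asboolP|?]; last apply/asboolP. Qed.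

Lemma toll_setP (F : sgraph) (S : {set F}) :
  toll_set S <->
  forall x, exists u v, [/\ u \in S, v \in S & x \in toll_interval u v].
Proof.
rewrite /toll_set -subTset; split=> [/subsetP cov x | cov].
  have /bigcupP[u uS /bigcupP[v vS xuv]] := cov x (in_setT x).
  by exists u, v.
apply/subsetP => x _; have [u [v [uS vS xuv]]] := cov x.
by apply/bigcupP; exists u => //; apply/bigcupP; exists v.
Qed.

Section Embedding.

Variables (F F' : sgraph) (f : F -> F').
Hypotheses (f_inj : injective f) (f_adj : forall a b, adj (f a) (f b) = adj a b).

(** Being tolled is a condition on adjacencies and non-adjacencies along the
    walk only, so it is preserved by an isomorphism onto an induced subgraph. *)
Lemma tolled_walk_emb (u v : F) (p : seq F) :
  tolled_walk u v p -> tolled_walk (f u) (f v) (map f p).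
Proof.
rewrite /tolled_walk (inj_eq f_inj) f_adj.
case: eqP => [_ -> //|_]; case: ifP => [_ -> //|_ [w -> [w_gt0 w_walk wu wv]]].
exists (map f w); first by rewrite /= map_rcons.
split; rewrite ?size_map //.
- by rewrite sorted_map (eq_sorted (e' := @adj F)).
- by move=> i lt_i; rewrite (nth_map u) // f_adj; apply: wu.
- by move=> i lt_i; rewrite (nth_map u) // f_adj; apply: wv.
Qed.

Lemma toll_interval_emb (u v x : F) :
  x \in toll_interval u v -> f x \in toll_interval (f u) (f v).
Proof.
move=> /mem_toll_interval[p uvp xp]; apply/mem_toll_interval.
by exists (map f p); [apply: tolled_walk_emb | apply: map_f].
Qed.

End Embedding.

Lemma toll_interval_common_nbr (F : sgraph) (u v x : F) :
  u != v -> ~~ adj u v -> adj u x -> adj v x -> x \in toll_interval u v.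
Proof.
move=> /negPf u_neq_v /negPf uv_nadj ux vx; apply/mem_toll_interval.
exists [:: u; x; v]; last by rewrite !inE eqxx orbT.
rewrite /tolled_walk u_neq_v uv_nadj; exists [:: x] => //.
by split=> // -[].
Qed.

Section LexicographicBound.

Variables G H : sgraph.

(** Since [H] has no loops, two points of the graph of [phi] with the same first
    coordinate are never adjacent in the product. *)
Lemma adj_lex_graph (phi : G -> H) (a b : G) :
  @adj (lex G H) (a, phi a) (b, phi b) = adj a b.
Proof.
rewrite /= /lex_adj /=; case: (eqVneq a b) => [->|_]; last by rewrite orbF.
by rewrite !adj_irrefl.
Qed.

Lemma toll_interval_lex (phi : G -> H) (u v x : G) :
  x \in toll_interval u v ->
  ((x, phi x) : lex G H) \in @toll_interval (lex G H) (u, phi u) (v, phi v).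
Proof.
apply: (@toll_interval_emb G (lex G H) (fun a => (a, phi a))).
  by move=> a b [].
exact: adj_lex_graph.
Qed.

(** Two vertices of one fibre, non-adjacent in [H], are both adjacent to all
    fibres over neighbours of their base point. *)
Lemma toll_interval_fibre (g d : G) (h1 h2 y : H) :
  h1 != h2 -> ~~ adj h1 h2 -> adj g d ->
  ((d, y) : lex G H) \in @toll_interval (lex G H) (g, h1) (g, h2).
Proof.
move=> h12 nadj_h gd.
apply: toll_interval_common_nbr; rewrite /= /lex_adj /= ?gd //.
  by apply: contraNneq h12 => -[->].
by rewrite adj_irrefl (negPf nadj_h) andbF.
Qed.

Lemma toll_number_lex_le (h1 h2 : H) (D P : {set G}) :
  h1 != h2 -> ~~ adj h1 h2 -> toll_set D ->
  (forall d, d \in D -> exists2 g, g \in P & adj g d) ->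
  toll_number (lex G H) <= #|D| + 2 * #|P|.
Proof.
move=> h12 nadj_h /toll_setP tollD domP.
pose S : {set lex G H} := setX D [set h1] :|: setX P [set h1; h2].
have memS a b : ((a, b) \in S) =
    (a \in D) && (b == h1) || (a \in P) && ((b == h1) || (b == h2)).
  by rewrite !inE.
have cardS : #|S| <= #|D| + 2 * #|P|.
  apply: leq_trans (leq_card_setU _ _) _.
  by rewrite !cardsX cards1 cards2 h12 muln1 (mulnC 2).
apply: leq_trans cardS; apply: (toll_numberP (lex G H)).2.
apply/toll_setP => -[x y].
have [xD | xND] := boolP (x \in D).
  have [g gP gx] := domP x xD.
  exists (g, h1), (g, h2).
  by rewrite !memS gP !eqxx !orbT; split=> //; apply: toll_interval_fibre.
have [u [v [uD vD xuv]]] := tollD x.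
exists (u, h1), (v, h1); rewrite !memS uD vD eqxx; split=> //.
pose phi a := if a == x then y else h1.
have phiD a : a \in D -> phi a = h1.
  by rewrite /phi; case: eqP => // -> /(negP xND).
have := toll_interval_lex phi xuv.
by rewrite (phiD u) // (phiD v) // /phi eqxx.
Qed.

End LexicographicBound.

Lemma connected_exists_nbr (G : sgraph) (x : G) :
  connected G -> nontrivial G -> exists y, adj y x.
Proof.
move=> G_conn G_nontriv.
have [y yx] : exists y, y != x.
  have /card_gt0P[y] : 0 < #|predC1 x|.
    by rewrite cardC1 -subn1 subn_gt0.
  by exists y.
have /connectP[[|z p] /= walk y_last] := G_conn x y.
  by rewrite y_last eqxx in yx.
by exists z; rewrite adj_sym; case/andP: walk.
Qed.

Lemma not_complete_exists (H : sgraph) :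
  ~ complete H -> exists h1 h2 : H, h1 != h2 /\ ~~ adj h1 h2.
Proof.
move=> H_ncomplete.
have [/existsP[h1 /existsP[h2 /andP[? ?]]] | none] :=
    boolP [exists h1 : H, exists h2 : H, (h1 != h2) && ~~ adj h1 h2].
  by exists h1, h2.
case: H_ncomplete => h1 h2 h12; apply: contraNT none => nadj_h.
by apply/existsP; exists h1; apply/existsP; exists h2; rewrite h12.
Qed.

Theorem lemma4p12 (G H : sgraph)
  (G_connected : connected G) (G_nontrivial : nontrivial G)
  (H_connected : connected H) (H_nontrivial : nontrivial H)
  (H_not_complete : ~ complete H)
  (tn_lex : toll_number (lex G H) = 3 * toll_number G) :
  forall D : {set G}, minimum_toll_set D ->
  forall u v : G, u \in D -> v \in D -> u <> v ->
  nbhd u :&: nbhd v = set0.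
Proof.
move=> D [tollD minD] u v uD vD /eqP u_neq_v.
apply/eqP; apply: contraT => /set0Pn[z]; rewrite !inE => /andP[uz vz].
have [h1 [h2 [h12 nadj_h]]] := not_complete_exists H_not_complete.
pose nbr d := xchoose (connected_exists_nbr d G_connected G_nontrivial).
have nbrP d : adj (nbr d) d.
  exact: xchooseP (connected_exists_nbr d G_connected G_nontrivial).
pose D' := D :\ u :\ v.
(* The vertex z dominates both u and v, which saves one element of P. *)
pose P := z |: nbr @: D'.
have cardD : #|D| = #|D'|.+2.
  by rewrite (cardsD1 u) uD (cardsD1 v) !inE eq_sym u_neq_v vD.
have cardP : #|P| <= #|D'|.+1.
  by rewrite cardsU1 -add1n leq_add ?leq_b1 // leq_imset_card.
have domP d : d \in D -> exists2 g, g \in P & adj g d.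
  move=> dD; have [->|du] := eqVneq d u.
    by exists z; rewrite ?setU11 // adj_sym.
  have [->|dv] := eqVneq d v.
    by exists z; rewrite ?setU11 // adj_sym.
  by exists (nbr d); rewrite ?setU1r ?imset_f // !inE dv du dD.
have := toll_number_lex_le h12 nadj_h tollD domP.
rewrite tn_lex -minD; lia.
Qed.
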